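(* Let $(A,\Delta_{\succ},\Delta_{\prec})$ be a Leibniz-dendriform coalgebra and $(B,\eta)$, $B=\bigoplus_{i\in\mathbb Z}B_i$, a completed Zinbiel coalgebra. Define a linear map $\delta:A\otimes B\to (A\otimes B)\,\hat\otimes\,(A\otimes B)$ by $$\delta(a\otimes x)=\Delta_{\succ}(a)\bullet\eta(x)-\tau\Delta_{\prec}(a)\bullet\hat\tau\eta(x)=\sum_{(a)}\sum_{i,j,\alpha}\Big((a_{1}\otimes x_{1,i,\alpha})\otimes(a_{2}\otimes x_{2,j,\alpha})-(a_{(2)}\otimes x_{2,j,\alpha})\otimes(a_{(1)}\otimes x_{1,i,\alpha})\Big)$$ for $a\in A$, $x\in B$, where $\Delta_{\succ}(a)=\sum_{(a)}a_1\otimes a_2$, $\Delta_{\prec}(a)=\sum_{(a)}a_{(1)}\otimes a_{(2)}$ and $\eta(x)=\sum_{i,j,\alpha}x_{1,i,\alpha}\otimes x_{2,j,\alpha}$. Then $(A\otimes B,\delta)$ is a completed pre-Lie coalgebra.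
   Context: All vector spaces are over a field $\mathbb K$; $\tau(u\otimes v)=v\otimes u$ is the flip and $I$ the identity. Standing convention of the paper: (co)algebras are finite-dimensional, except $\mathbb Z$-graded ones. Completed tensor products: for $\mathbb Z$-graded spaces $U=\bigoplus_iU_i$, $V=\bigoplus_jV_j$, $U\hat\otimes V:=\prod_{i,j\in\mathbb Z}U_i\otimes V_j$ (similarly for three factors); elements are formal sums $\sum_{i,j,\alpha}u_{i,\alpha}\otimes v_{j,\alpha}$ with $u_{i,\alpha}\in U_i$, $v_{j,\alpha}\in V_j$ and finitely many $\alpha$ for each $(i,j)$. Linear maps are extended termwise, $(\varphi\hat\otimes\psi)(\sum u_{i,\alpha}\otimes v_{j,\alpha})=\sum\varphi(u_{i,\alpha})\otimes\psi(v_{j,\alpha})$, and $\hat\tau$ is the extended flip; it is understood that the composites written below are well defined, i.e. each homogeneous component is a finite sum. $A$ is ungraded (placed in degree $0$) and $A\otimes B=\bigoplus_i A\otimes B_i$. The symbol $\bullet$ denotes $(a_1\otimes a_2)\bullet(x_1\otimes x_2)=(a_1\otimes x_1)\otimes(a_2\otimes x_2)$, extended linearly to (formal) sums. Leibniz-dendriform coalgebra $(A,\Delta_\succ,\Delta_\prec)$: linear maps $\Delta_\succ,\Delta_\prec:A\to A\otimes A$ such that, with $\Delta=\Delta_\succ+\Delta_\prec$, $(\Delta\otimes I)\Delta_{\succ}=(I\otimes\Delta_{\succ})\Delta_{\succ}-(\tau\otimes I)(I\otimes\Delta_{\succ})\Delta_{\succ}$; $(I\otimes\Delta_{\prec})\Delta_{\succ}-(\Delta_{\succ}\otimes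 I)\Delta_{\prec}=(\tau\otimes I)(I\otimes\Delta)\Delta_{\prec}$; $(I\otimes\Delta)\Delta_{\prec}=(\Delta_{\prec}\otimes I)\Delta_{\prec}+(\tau\otimes I)(I\otimes\Delta_{\prec})\Delta_{\succ}$. Completed Zinbiel coalgebra $(B,\eta)$: $B=\bigoplus_{i\in\mathbb Z}B_i$ graded, $\eta:B\to B\hat\otimes B$ linear with $(I\hat\otimes\eta)\eta=(\hat\tau\hat\otimes I)(I\hat\otimes\eta)\eta=(\eta\hat\otimes I)\eta+(\hat\tau\hat\otimes I)(\eta\hat\otimes I)\eta$. Completed pre-Lie coalgebra $(L,\delta)$: $L=\bigoplus_iL_i$ graded, $\delta:L\to L\hat\otimes L$ linear with $(I\hat\otimes\delta)\delta-(\hat\tau\hat\otimes I)(I\hat\otimes\delta)\delta=(\delta\hat\otimes I)\delta-(\hat\tau\hat\otimes I)(\delta\hat\otimes I)\delta$. *)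

(* Defs.v *)
From HB Require Import structures.
From mathcomp Require Import all_boot all_order all_algebra.
From mathcomp Require Import boolp classical_sets functions cardinality fsbigop.

Set Implicit Arguments.
Unset Strict Implicit.
Unset Printing Implicit Defensive.

Import GRing.Theory.
Local Open Scope ring_scope.
Local Open Scope quotient_scope.
Local Open Scope classical_set_scope.

Reserved Notation "U \otimes V" (at level 40, left associativity).
Reserved Notation "u \ox v" (at level 40, left associativity).
Reserved Notation "U \ohat V" (at level 40, left associativity).

(* Tensor product of two vector spaces, of any dimension.  A finite sequence
   of pairs [:: (u_1, v_1); ...] stands for the sum of the u_k (x) v_k, and
   tens_eq is the congruence generated by the bilinearity relations. *)

Section TensorProduct.
Variables (K : fieldType) (U V : lmodType K).

Inductive tens_eq : seq (U * V) -> seq (U * V) -> Prop :=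
| tens_eq_refl s : tens_eq s s
| tens_eq_sym s t : tens_eq s t -> tens_eq t s
| tens_eq_trans s t r : tens_eq s t -> tens_eq t r -> tens_eq s r
| tens_eq_cat s s' t t' :
    tens_eq s s' -> tens_eq t t' -> tens_eq (s ++ t) (s' ++ t')
| tens_eq_catC s t : tens_eq (s ++ t) (t ++ s)
| tens_eq_0l v : tens_eq [:: (0, v)] [::]
| tens_eq_Dl u u' v : tens_eq [:: (u + u', v)] [:: (u, v); (u', v)]
| tens_eq_Dr u v v' : tens_eq [:: (u, v + v')] [:: (u, v); (u, v')]
| tens_eq_Z a u v : tens_eq [:: (a *: u, v)] [:: (u, a *: v)].

Definition tens_eqb : rel (seq (U * V)) := fun s t => `[< tens_eq s t >].

Lemma tens_eqb_refl : reflexive tens_eqb.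
Proof. by move=> s; apply/asboolP; exact: tens_eq_refl. Qed.

Lemma tens_eqb_sym : symmetric tens_eqb.
Proof. by move=> s t; apply/asboolP/asboolP; exact: tens_eq_sym. Qed.

Lemma tens_eqb_trans : transitive tens_eqb.
Proof.
move=> t s r /asboolP st /asboolP tr; apply/asboolP.
exact: tens_eq_trans st tr.
Qed.

Canonical tens_equiv :=
  EquivRel tens_eqb tens_eqb_refl tens_eqb_sym tens_eqb_trans.

Definition tens := {eq_quot tens_equiv}.

HB.instance Definition _ := Choice.on tens.
HB.instance Definition _ : EqQuotient _ tens_equiv tens := EqQuotient.on tens.

Lemma tens_piP (s t : seq (U * V)) :
  reflect (tens_eq s t) (\pi_tens s == \pi_tens t).
Proof. by rewrite piE; exact: asboolP. Qed.

Lemma tens_pi_eq (s t : seq (U * V)) : tens_eq s t -> \pi_tens s = \pi_tens t.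
Proof. by move=> /tens_piP/eqP. Qed.

Lemma tens_repr_pi (s : seq (U * V)) : tens_eq (repr (\pi_tens s)) s.
Proof. by apply/tens_piP; rewrite reprK. Qed.

Definition tens_scale_seq (a : K) : seq (U * V) -> seq (U * V) :=
  map (fun p => (a *: p.1, p.2)).

Lemma tens_scale_seq_eq a s t :
  tens_eq s t -> tens_eq (tens_scale_seq a s) (tens_scale_seq a t).
Proof.
elim=> {s t} /=.
- by move=> s; exact: tens_eq_refl.
- by move=> s t _; exact: tens_eq_sym.
- by move=> s t r _ st _; exact: tens_eq_trans.
- move=> s s' t t' _ ss' _ tt'; rewrite /tens_scale_seq !map_cat.
  exact: tens_eq_cat.
- by move=> s t; rewrite /tens_scale_seq !map_cat; exact: tens_eq_catC.
- by move=> v; rewrite scaler0; exact: tens_eq_0l.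
- by move=> u u' v; rewrite scalerDr; exact: tens_eq_Dl.
- by move=> u v v'; exact: tens_eq_Dr.
- by move=> b u v; rewrite scalerA mulrC -scalerA; exact: tens_eq_Z.
Qed.

Definition tens_add (x y : tens) : tens := \pi_tens (repr x ++ repr y).
Definition tens_zero : tens := \pi_tens [::].
Definition tens_scale (a : K) (x : tens) : tens :=
  \pi_tens (tens_scale_seq a (repr x)).
Definition tens_opp (x : tens) : tens := tens_scale (-1) x.

Lemma tens_add_pi s t :
  tens_add (\pi_tens s) (\pi_tens t) = \pi_tens (s ++ t).
Proof. by apply: tens_pi_eq; apply: tens_eq_cat; exact: tens_repr_pi. Qed.

Lemma tens_scale_pi a s :
  tens_scale a (\pi_tens s) = \pi_tens (tens_scale_seq a s).
Proof. by apply: tens_pi_eq; apply: tens_scale_seq_eq; exact: tens_repr_pi. Qed.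

Lemma tens_addA : associative tens_add.
Proof.
move=> x y z; rewrite -[x]reprK -[y]reprK -[z]reprK.
move: (repr x) (repr y) (repr z) => s t r.
by rewrite (tens_add_pi t r) (tens_add_pi s t) !tens_add_pi catA.
Qed.

Lemma tens_addC : commutative tens_add.
Proof.
move=> x y; rewrite -[x]reprK -[y]reprK !tens_add_pi.
by apply: tens_pi_eq; exact: tens_eq_catC.
Qed.

Lemma tens_add0 : left_id tens_zero tens_add.
Proof. by move=> x; rewrite -[x]reprK tens_add_pi. Qed.

Lemma tens_scale_seqDl a b s :
  tens_eq (tens_scale_seq (a + b) s) (tens_scale_seq a s ++ tens_scale_seq b s).
Proof.
elim: s => [|[u v] s IHs] /=; first exact: tens_eq_refl.
rewrite scalerDl.
apply: (tens_eq_trans (t := [:: (a *: u, v); (b *: u, v)] ++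
         (tens_scale_seq a s ++ tens_scale_seq b s))).
  apply: (tens_eq_cat (s := [:: _]) _ IHs); exact: tens_eq_Dl.
apply: (@tens_eq_cat [:: (a *: u, v)] [:: (a *: u, v)]).
  exact: tens_eq_refl.
rewrite -cat1s -[X in tens_eq _ X](cat_rcons (b *: u, v)) -cats1 !catA.
apply: tens_eq_cat; last exact: tens_eq_refl.
exact: tens_eq_catC.
Qed.

Lemma tens_scale0_seq s : tens_eq (tens_scale_seq 0 s) [::].
Proof.
elim: s => [|[u v] s IHs] /=; first exact: tens_eq_refl.
rewrite scale0r; apply: (tens_eq_cat (s := [:: _]) (s' := [::]) _ IHs).
exact: tens_eq_0l.
Qed.

Lemma tens_scale1 : left_id 1 tens_scale.
Proof.
move=> x; rewrite -[x]reprK tens_scale_pi; congr (\pi_tens _).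
by elim: (repr x) => [|[u v] s IHs] //=; rewrite scale1r IHs.
Qed.

Lemma tens_scaleA a b x : tens_scale a (tens_scale b x) = tens_scale (a * b) x.
Proof.
rewrite -[x]reprK; move: (repr x) => s.
rewrite (tens_scale_pi b s) !tens_scale_pi; congr (\pi_tens _).
rewrite /tens_scale_seq -map_comp; apply: eq_map => -[u v] /=.
by rewrite scalerA.
Qed.

Lemma tens_scaleDl x a b :
  tens_scale (a + b) x = tens_add (tens_scale a x) (tens_scale b x).
Proof.
rewrite -[x]reprK; move: (repr x) => s.
rewrite (tens_scale_pi a s) (tens_scale_pi b s) tens_scale_pi tens_add_pi.
by apply: tens_pi_eq; exact: tens_scale_seqDl.
Qed.

Lemma tens_scaleDr : right_distributive tens_scale tens_add.
Proof.
move=> a x y; rewrite -[x]reprK -[y]reprK; move: (repr x) (repr y) => s t.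
rewrite (tens_add_pi s t) (tens_scale_pi a s) (tens_scale_pi a t).
by rewrite tens_scale_pi tens_add_pi /tens_scale_seq map_cat.
Qed.

Lemma tens_addN : left_inverse tens_zero tens_opp tens_add.
Proof.
move=> x; rewrite /tens_opp -{2}[x]tens_scale1 -tens_scaleDl addNr.
by rewrite -[x]reprK tens_scale_pi; apply: tens_pi_eq; exact: tens_scale0_seq.
Qed.

HB.instance Definition _ :=
  GRing.isZmodule.Build tens tens_addA tens_addC tens_add0 tens_addN.

HB.instance Definition _ :=
  GRing.Zmodule_isLmodule.Build K tens
    tens_scaleA tens_scale1 tens_scaleDr tens_scaleDl.

Definition otimes (u : U) (v : V) : tens := \pi_tens [:: (u, v)].

End TensorProduct.

Arguments otimes {K U V} u v.
Notation "U \otimes V" := (tens U V) : type_scope.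
Notation "u \ox v" := (otimes u v) : ring_scope.

Section TensorTheory.
Variables (K : fieldType) (U V : lmodType K).
Implicit Types (u : U) (v : V).

Lemma otimesDl u u' v : (u + u') \ox v = u \ox v + u' \ox v.
Proof.
by rewrite /otimes [RHS]tens_add_pi; apply: tens_pi_eq; exact: tens_eq_Dl.
Qed.

Lemma otimesDr u v v' : u \ox (v + v') = u \ox v + u \ox v'.
Proof.
by rewrite /otimes [RHS]tens_add_pi; apply: tens_pi_eq; exact: tens_eq_Dr.
Qed.

Lemma otimesZl a u v : (a *: u) \ox v = a *: (u \ox v).
Proof. by rewrite /otimes [RHS]tens_scale_pi. Qed.

Lemma otimesZr a u v : u \ox (a *: v) = a *: (u \ox v).
Proof.
by rewrite -otimesZl; apply: tens_pi_eq; apply/tens_eq_sym/tens_eq_Z.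
Qed.

Lemma otimes_bilinear :
  bilinear_for ( *:%R : K -> U \otimes V -> U \otimes V)
               ( *:%R : K -> U \otimes V -> U \otimes V)
               (@otimes K U V).
Proof.
split=> [v a u u'|u a v v'].
  by rewrite /= otimesDl otimesZl.
by rewrite /= otimesDr otimesZr.
Qed.

HB.instance Definition _ :=
  bilinear_isBilinear.Build K U V (U \otimes V) _ _ (@otimes K U V)
    otimes_bilinear.

Lemma tens_sum (t : U \otimes V) : t = \sum_(p <- repr t) p.1 \ox p.2.
Proof.
rewrite -{1}[t]reprK; elim: (repr t) => [|[u v] s IHs]; first by rewrite big_nil.
by rewrite big_cons -IHs [RHS]tens_add_pi.
Qed.

Lemma tens_ind (P : U \otimes V -> Prop) :
  P 0 -> (forall u v t, P t -> P (u \ox v + t)) -> forall t, P t.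
Proof.
move=> P0 PS t; rewrite [t]tens_sum.
elim: (repr t) => [|[u v] s IHs]; first by rewrite big_nil.
by rewrite big_cons; exact: PS.
Qed.

End TensorTheory.

(* For f bilinear, the linear map u \ox v |-> f u v; see tliftE. *)
Definition tlift (K : fieldType) (U V W : lmodType K) (f : U -> V -> W)
    (t : U \otimes V) : W :=
  \sum_(p <- repr t) f p.1 p.2.

Definition is_bilinear (K : fieldType) (U V W : lmodType K)
    (f : U -> V -> W) : Prop :=
  (forall v, linear (f^~ v)) /\ (forall u, linear (f u)).

Section TensorLift.
Variables (K : fieldType) (U V W : lmodType K) (f : U -> V -> W).
Hypothesis f_bilinear : is_bilinear f.

Let f_linearl v : {linear U -> W} :=
  HB.pack (f^~ v) (GRing.isLinear.Build K U W *:%R (f^~ v) (f_bilinear.1 v)).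
Let f_linearr u : {linear V -> W} :=
  HB.pack (f u) (GRing.isLinear.Build K V W *:%R (f u) (f_bilinear.2 u)).

Lemma tlift_seq (s t : seq (U * V)) : tens_eq s t ->
  \sum_(p <- s) f p.1 p.2 = \sum_(p <- t) f p.1 p.2.
Proof.
elim=> {s t} //.
- by move=> s t r _ -> _ ->.
- by move=> s s' t t' _ ss' _ tt'; rewrite !big_cat /= ss' tt'.
- by move=> s t; rewrite !big_cat /= addrC.
- by move=> v; rewrite big_seq1 big_nil; exact: (linear0 (f_linearl v)).
- move=> u u' v; rewrite !big_cons !big_nil !addr0.
  exact: (linearD (f_linearl v)).
- move=> u v v'; rewrite !big_cons !big_nil !addr0.
  exact: (linearD (f_linearr u)).
- move=> a u v; rewrite !big_seq1.
  by rewrite [LHS](linearZ_LR (f_linearl v)) [RHS](linearZ_LR (f_linearr u)).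
Qed.

Lemma tlift_pi (s : seq (U * V)) :
  tlift f (\pi_(U \otimes V) s) = \sum_(p <- s) f p.1 p.2.
Proof. by apply: tlift_seq; exact: tens_repr_pi. Qed.

Lemma tliftE u v : tlift f (u \ox v) = f u v.
Proof. by rewrite tlift_pi big_seq1. Qed.

Lemma tlift_linear : linear (tlift f).
Proof.
move=> a x y; rewrite -[x]reprK -[y]reprK; move: (repr x) (repr y) => s t.
rewrite -[a *: _]/(tens_scale a _) tens_scale_pi.
rewrite -[_ + _]/(tens_add _ _) tens_add_pi !tlift_pi big_cat /=.
congr (_ + _); rewrite /tens_scale_seq big_map scaler_sumr.
by apply: eq_bigr => p _; exact: (linearZ_LR (f_linearl p.2)).
Qed.

End TensorLift.

Lemma tlift_linear_fun (K : fieldType) (U V W : lmodType K) (f g : U -> V -> W)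
    a t :
  tlift (fun u v => a *: f u v + g u v) t = a *: tlift f t + tlift g t.
Proof. by rewrite /tlift big_split scaler_sumr. Qed.

Section TensorMaps.
Variable K : fieldType.
Implicit Types U V W X Y : lmodType K.

Definition tflip U V : U \otimes V -> V \otimes U :=
  tlift (fun u v => v \ox u).

Definition tmap U V W X (f : {linear U -> W}) (g : {linear V -> X}) :
    U \otimes V -> W \otimes X :=
  tlift (fun u v => f u \ox g v).

Definition tassoc U V W : U \otimes (V \otimes W) -> (U \otimes V) \otimes W :=
  tlift (fun u => tlift (fun v w => (u \ox v) \ox w)).

(* (a1 \ox a2) \bullet (x1 \ox x2) = (a1 \ox x1) \ox (a2 \ox x2) *)
Definition bullet U V X Y (T : U \otimes V) (t : X \otimes Y) :
    (U \otimes X) \otimes (V \otimes Y) :=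
  tlift (fun a1 a2 => tlift (fun x1 x2 => (a1 \ox x1) \ox (a2 \ox x2)) t) T.

Lemma tflip_bilinear U V : is_bilinear (fun (u : U) (v : V) => v \ox u).
Proof.
by split=> [v a u u'|u a v v']; rewrite ?otimesDl ?otimesDr ?otimesZl ?otimesZr.
Qed.

Lemma tmap_bilinear U V W X (f : {linear U -> W}) (g : {linear V -> X}) :
  is_bilinear (fun u v => f u \ox g v).
Proof.
split=> [v a u u'|u a v v']; rewrite linearP.
  by rewrite otimesDl otimesZl.
by rewrite otimesDr otimesZr.
Qed.

Lemma tassoc_bilinear_in U V W (u : U) :
  is_bilinear (fun (v : V) (w : W) => (u \ox v) \ox w).
Proof.
split=> [w a v v'|v a w w']; last by rewrite otimesDr otimesZr.
by rewrite otimesDr otimesZr otimesDl otimesZl.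
Qed.

Lemma tassoc_bilinear U V W :
  is_bilinear (fun u : U => tlift (fun (v : V) (w : W) => (u \ox v) \ox w)).
Proof.
split=> [t a u u'|u]; last exact/tlift_linear/tassoc_bilinear_in.
rewrite -tlift_linear_fun; congr (tlift _ t).
by apply/funext => v; apply/funext => w; rewrite !(otimesDl, otimesZl).
Qed.

Lemma bullet_bilinear_in U V X Y (u : U) (v : V) :
  is_bilinear (fun (x : X) (y : Y) => (u \ox x) \ox (v \ox y)).
Proof.
by split=> [y a x x'|x a y y']; rewrite !(otimesDl, otimesDr, otimesZl, otimesZr).
Qed.

Lemma bullet_bilinear_out U V X Y (t : X \otimes Y) :
  is_bilinear (fun (u : U) (v : V) =>
    tlift (fun x y => (u \ox x) \ox (v \ox y)) t).
Proof.
split=> [v a u u'|u a v v'] /=; rewrite -tlift_linear_fun; congr (tlift _ t);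
apply/funext => x; apply/funext => y;
by rewrite !(otimesDl, otimesDr, otimesZl, otimesZr).
Qed.

Lemma tflipE U V (u : U) (v : V) : tflip (u \ox v) = v \ox u.
Proof. by rewrite /tflip tliftE//; exact: tflip_bilinear. Qed.

Lemma tmapE U V W X (f : {linear U -> W}) (g : {linear V -> X}) u v :
  tmap f g (u \ox v) = f u \ox g v.
Proof. by rewrite /tmap tliftE//; exact: tmap_bilinear. Qed.

Lemma tassocE U V W (u : U) (v : V) (w : W) :
  tassoc (u \ox (v \ox w)) = (u \ox v) \ox w.
Proof.
rewrite /tassoc tliftE; last exact: tassoc_bilinear.
by rewrite tliftE//; exact: tassoc_bilinear_in.
Qed.

Lemma bulletE U V X Y (u : U) (v : V) (x : X) (y : Y) :
  bullet (u \ox v) (x \ox y) = (u \ox x) \ox (v \ox y).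
Proof.
rewrite /bullet tliftE; last exact: bullet_bilinear_out.
by rewrite tliftE//; exact: bullet_bilinear_in.
Qed.

Lemma bullet_bilinear U V X Y : is_bilinear (@bullet U V X Y).
Proof.
split=> [t|T a t t']; first exact/tlift_linear/bullet_bilinear_out.
rewrite /bullet -tlift_linear_fun; congr (tlift _ T).
apply/funext => u; apply/funext => v.
by rewrite tlift_linear//; exact: bullet_bilinear_in.
Qed.

HB.instance Definition _ U V :=
  GRing.isLinear.Build K (U \otimes V) (V \otimes U) *:%R (@tflip U V)
    (tlift_linear (@tflip_bilinear U V)).

HB.instance Definition _ U V W X (f : {linear U -> W}) (g : {linear V -> X}) :=
  GRing.isLinear.Build K (U \otimes V) (W \otimes X) *:%R (tmap f g)
    (tlift_linear (tmap_bilinear f g)).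

HB.instance Definition _ U V W :=
  GRing.isLinear.Build K (U \otimes (V \otimes W)) ((U \otimes V) \otimes W)
    *:%R (@tassoc U V W) (tlift_linear (@tassoc_bilinear U V W)).

End TensorMaps.

(* Direct product of a family of vector spaces. *)
Definition dprod (K : fieldType) (I : Type) (U : I -> lmodType K) :=
  forall i, U i.

Section DirectProduct.
Variables (K : fieldType) (I : Type) (U : I -> lmodType K).
Local Notation P := (dprod U).

HB.instance Definition _ := gen_eqMixin P.
HB.instance Definition _ := gen_choiceMixin P.

Let dprod_add (x y : P) : P := fun i => x i + y i.
Let dprod_zero : P := fun=> 0.
Let dprod_opp (x : P) : P := fun i => - x i.
Let dprod_scale (a : K) (x : P) : P := fun i => a *: x i.

Let dprodP (x y : P) : (forall i, x i = y i) -> x = y.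
Proof. exact: functional_extensionality_dep. Qed.

Let dprod_addA : associative dprod_add.
Proof. by move=> x y z; apply: dprodP => i; exact: addrA. Qed.
Let dprod_addC : commutative dprod_add.
Proof. by move=> x y; apply: dprodP => i; exact: addrC. Qed.
Let dprod_add0 : left_id dprod_zero dprod_add.
Proof. by move=> x; apply: dprodP => i; exact: add0r. Qed.
Let dprod_addN : left_inverse dprod_zero dprod_opp dprod_add.
Proof. by move=> x; apply: dprodP => i; exact: addNr. Qed.

HB.instance Definition _ :=
  GRing.isZmodule.Build P dprod_addA dprod_addC dprod_add0 dprod_addN.

Let dprod_scaleA a b x : dprod_scale a (dprod_scale b x) = dprod_scale (a * b) x.
Proof. by apply: dprodP => i; exact: scalerA. Qed.
Let dprod_scale1 : left_id 1 dprod_scale.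
Proof. by move=> x; apply: dprodP => i; exact: scale1r. Qed.
Let dprod_scaleDr : right_distributive dprod_scale +%R.
Proof. by move=> a x y; apply: dprodP => i; exact: scalerDr. Qed.
Let dprod_scaleDl x : {morph dprod_scale^~ x : a b / a + b}.
Proof. by move=> a b; apply: dprodP => i; exact: scalerDl. Qed.

HB.instance Definition _ :=
  GRing.Zmodule_isLmodule.Build K P
    dprod_scaleA dprod_scale1 dprod_scaleDr dprod_scaleDl.

End DirectProduct.

Section DirectSum.
Variables (K : fieldType) (I : choiceType) (U : I -> lmodType K).

(* Direct sum: the families with finite support. *)
Definition finsupp_family : {pred dprod U} :=
  [pred x : dprod U | `[< finite_set [set i | x i != 0] >]].

Record dsum := DSum {
  dsum_val : dprod U;
  _ : dsum_val \in finsupp_family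
}.

HB.instance Definition _ := [isSub for dsum_val].
HB.instance Definition _ := [Choice of dsum by <:].

Lemma finsupp_family_submod : submod_closed finsupp_family.
Proof.
split=> [|a x y /asboolP xfin /asboolP yfin]; apply/asboolP.
  by apply: (sub_finite_set _ (finite_set0 I)) => i /=; rewrite eqxx.
have xyfin : finite_set ([set i | x i != 0] `|` [set i | y i != 0]).
  by rewrite finite_setU.
apply: sub_finite_set xyfin => i /= xyi.
have [xi0|] := eqVneq (x i) 0; last by left.
right; apply: contra xyi => /eqP yi0; apply/eqP.
by rewrite -[LHS]/(a *: x i + y i) xi0 yi0 scaler0 addr0.
Qed.

HB.instance Definition _ :=
  GRing.isSubmodClosed.Build K (dprod U) finsupp_family finsupp_family_submod.
HB.instance Definition _ := [SubChoice_isSubLmodule of dsum by <:].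

Lemma dsum_val_linear : linear dsum_val.
Proof. exact: (linearP (val : dsum -> dprod U)). Qed.

HB.instance Definition _ :=
  GRing.isLinear.Build K dsum (dprod U) *:%R dsum_val dsum_val_linear.

Lemma homog_finsupp i (u : U i) :
  (dfwith (fun=> 0) u : dprod U) \in finsupp_family.
Proof.
apply/asboolP; apply: (sub_finite_set _ (finite_set1 i)) => j /=.
by apply: contraNeq => ji; rewrite dfwith_out// eq_sym.
Qed.

(* The element u of degree i of the direct sum. *)
Definition homog i (u : U i) : dsum := DSum (homog_finsupp u).

End DirectSum.

Section CompletedTensor.
Variable K : fieldType.

Definition ctens (I J : Type) (U : I -> lmodType K) (V : J -> lmodType K) :
    I * J -> lmodType K :=
  fun p => U p.1 \otimes V p.2 : lmodType K.

(* The homogeneous components of the tensor product of A, placed in degree 0,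
   with the direct sum of the B i. *)
Definition gtens (A : lmodType K) (I : Type) (B : I -> lmodType K) :
    I -> lmodType K :=
  fun i => A \otimes B i : lmodType K.

End CompletedTensor.

Notation "U \ohat V" := (dprod (ctens U V)) : type_scope.

Section CompletedMaps.
Variable K : fieldType.

Section Component.
Variables (I : choiceType) (J : Type).
Variables (U : I -> lmodType K) (V : J -> lmodType K).

(* The component U_i -> V_p of a linear map. *)
Definition component (phi : {linear dsum U -> dprod V}) (i : I) (p : J) :
    U i -> V p :=
  fun u => phi (homog u) p.
Arguments component : clear implicits.

Lemma homog_linear i : linear (@homog K I U i).
Proof.
move=> a u u'; apply/val_inj; rewrite linearP.
apply: functional_extensionality_dep => j.
rewrite -[RHS]/(a *: dsum_val (homog u) j + dsum_val (homog u') j) /=.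
have [<-|ij] := eqVneq i j; first by rewrite !dfwith_in.
by rewrite !dfwith_out// scaler0 addr0.
Qed.

Lemma component_linear phi i p : linear (component phi i p).
Proof. by move=> a u u'; rewrite /component homog_linear linearP. Qed.

HB.instance Definition _ phi i p :=
  GRing.isLinear.Build K (U i) (V p) *:%R (component phi i p)
    (@component_linear phi i p).

End Component.

Arguments component {I J U V} phi i p u.

Section Map.
Variables (I J : choiceType) (P Q : Type).
Variables (U : I -> lmodType K) (V : J -> lmodType K).
Variables (U' : P -> lmodType K) (V' : Q -> lmodType K).
Variables (phi : {linear dsum U -> dprod U'}) (psi : {linear dsum V -> dprod V'}).

(* The contribution of the component of t of degree (i, j) to the component
   of degree (p, q) of its image under the completed tensor product of phi
   and psi. *)
Definition ctmap_term (t : U \ohat V) (pq : P * Q) (ij : I * J) :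
    ctens U' V' pq :=
  tmap (component phi ij.1 pq.1) (component psi ij.2 pq.2) (t ij).

Definition ctmap_defined (t : U \ohat V) : Prop :=
  forall pq, finite_set [set ij | ctmap_term t pq ij != 0].

(* Meaningful only when ctmap_defined t holds: a finitary sum with infinite
   support is 0 by convention. *)
Definition ctmap (t : U \ohat V) : U' \ohat V' :=
  fun pq => \sum_(ij \in [set: I * J]) ctmap_term t pq ij.

End Map.

Definition cflip (I J : Type) (U : I -> lmodType K) (V : J -> lmodType K)
    (t : U \ohat V) : V \ohat U :=
  fun p => tflip (t (p.2, p.1)).

Definition cassoc (I J L : Type) (U : I -> lmodType K) (V : J -> lmodType K)
    (W : L -> lmodType K) (t : U \ohat (ctens V W)) : (ctens U V) \ohat W :=
  fun p => tassoc (t (p.1.1, (p.1.2, p.2))).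

(* The completed tensor product of the flip of U and V with the identity
   of W. *)
Definition cflipl (I J L : Type) (U : I -> lmodType K) (V : J -> lmodType K)
    (W : L -> lmodType K) (t : (ctens U V) \ohat W) : (ctens V U) \ohat W :=
  fun p => tmap (@tflip K (U p.1.2) (V p.1.1)) idfun (t ((p.1.2, p.1.1), p.2)).

Definition cbullet (A A' : lmodType K) (I J : Type) (U : I -> lmodType K)
    (V : J -> lmodType K) (T : A \otimes A') (t : U \ohat V) :
    gtens A U \ohat gtens A' V :=
  fun p => bullet T (t p).

End CompletedMaps.

Section Coalgebras.
Variable K : fieldType.

(* Here and below, iterated tensor products are left-associated: tassoc and
   cassoc transport the images of I (x) D to that form.  Ds and Dp stand for
   Delta_succ and Delta_prec. *)
Record leibniz_dendriform_coalgebra (A : vectType K)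
    (Ds Dp : {linear A -> A \otimes A}) : Prop := {
  ldc_s : forall a,
    tmap (Ds \+ Dp) idfun (Ds a) =
    tassoc (tmap idfun Ds (Ds a))
    - tmap (@tflip K A A) idfun (tassoc (tmap idfun Ds (Ds a)));
  ldc_sp : forall a,
    tassoc (tmap idfun Dp (Ds a)) - tmap Ds idfun (Dp a) =
    tmap (@tflip K A A) idfun (tassoc (tmap idfun (Ds \+ Dp) (Dp a)));
  ldc_p : forall a,
    tassoc (tmap idfun (Ds \+ Dp) (Dp a)) =
    tmap Dp idfun (Dp a)
    + tmap (@tflip K A A) idfun (tassoc (tmap idfun Dp (Ds a)))
}.

Section Graded.
Variables (B : int -> lmodType K) (eta : {linear dsum B -> B \ohat B}).

(* (I (x) eta) eta and (eta (x) I) eta, where the inclusion dsum_val of the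
   direct sum into the direct product plays the role of I. *)
Definition coiter_r (x : dsum B) : (ctens B B) \ohat B :=
  cassoc (ctmap (@dsum_val K _ B) eta (eta x)).

Definition coiter_l (x : dsum B) : (ctens B B) \ohat B :=
  ctmap eta (@dsum_val K _ B) (eta x).

Definition iterates_defined : Prop :=
  forall x, ctmap_defined (@dsum_val K _ B) eta (eta x) /\
            ctmap_defined eta (@dsum_val K _ B) (eta x).

Record completed_zinbiel_coalgebra : Prop := {
  czc_defined : iterates_defined;
  czc_flip : forall x, coiter_r x = cflipl (coiter_r x);
  czc_iterate : forall x, cflipl (coiter_r x) = coiter_l x + cflipl (coiter_l x)
}.

Record completed_prelie_coalgebra : Prop := {
  cpl_defined : iterates_defined;
  cpl_iterate : forall x,
    coiter_r x - cflipl (coiter_r x) = coiter_l x - cflipl (coiter_l x)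
}.

End Graded.

Lemma gtens_finsupp (A : lmodType K) (B : int -> lmodType K) (a : A)
    (x : dsum B) :
  ((fun i => a \ox dsum_val x i) : dprod (gtens A B)) \in @finsupp_family K int (gtens A B).
Proof.
case: x => x /= /asboolP xfin; apply/asboolP; apply: sub_finite_set xfin => i /=.
by apply: contraNN => /eqP ->; rewrite -(scale0r 0) otimesZr scale0r.
Qed.

Definition gotimes (A : lmodType K) (B : int -> lmodType K) (a : A)
    (x : dsum B) : dsum (gtens A B) :=
  DSum (gtens_finsupp a x).

End Coalgebras.

(* Main.v *)
(* Let t12 and t23 be the transpositions of tensor factors, and write l and r
   for (eta (x) I) eta x and (I (x) eta) eta x.  On a (x) x both iterates of
   delta are sums of terms sT . st, where s is a permutation of the three
   factors, T is one of the eight elements of A (x) A (x) A obtained by iterating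
   Delta_succ and Delta_prec on a, and t is l or r.  The Zinbiel axioms amount
   to r = t12 r = l + t12 l, so the pre-Lie identity becomes the vanishing of
   the coefficients in A (x) A (x) A of the six permutations of l.  The
   coefficients of l, of t23 l and of t23 t12 l vanish by the three
   Leibniz-dendriform axioms respectively, and the other three are, up to
   sign, their images under t12.  General elements of A (x) B reduce to sums of a (x) x by means of
   a basis of A, which also yields the existence of delta. *)

From HB Require Import structures.
Require Import Defs.
From mathcomp Require Import all_boot all_order all_algebra.
From mathcomp Require Import boolp classical_sets functions cardinality fsbigop.

Import GRing.Theory.
Local Open Scope ring_scope.

Set Implicit Arguments.
Unset Strict Implicit.
Unset Printing Implicit Defensive.

(** * Sums of families with finite support *)

Section FiniteSums.
Local Open Scope classical_set_scope.
Variables (K : fieldType) (I : choiceType).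
Implicit Types (U V : lmodType K).

(** A finitary sum with infinite support is 0 by convention, so the value alone would say nothing
    about convergence. Carrying the finite support along lets the same argument prove that the
    iterates are defined and compute them. *)
Definition finsum_to U (F : I -> U) (s : U) : Prop :=
  finite_set [set i | F i != 0] /\ \sum_(i \in [set: I]) F i = s.

Lemma fsumT_widen U (D : set I) (F : I -> U) :
  (forall i, F i != 0 -> D i) ->
  \sum_(i \in [set: I]) F i = \sum_(i \in D) F i.
Proof.
move=> FD; apply/esym/fsbig_widen => // i [_ nDi] /=.
by apply/eqP; apply: contra_notT nDi; exact: FD.
Qed.

Lemma eq_finsum_to U (F G : I -> U) s : F =1 G -> finsum_to G s -> finsum_to F s.
Proof. by move=> /funext ->. Qed.

Lemma finsum_to0 U : finsum_to (fun=> 0 : U) 0.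
Proof.
split; last by rewrite fsbig1.
by apply: (sub_finite_set _ (finite_set0 I)) => i /=; rewrite eqxx.
Qed.

Lemma finsum_toD U (F G : I -> U) s t :
  finsum_to F s -> finsum_to G t -> finsum_to (fun i => F i + G i) (s + t).
Proof.
move=> [finF <-] [finG <-].
set D := [set i | F i != 0] `|` [set i | G i != 0].
have finD : finite_set D by rewrite finite_setU.
have FD i : F i != 0 -> D i by left.
have GD i : G i != 0 -> D i by right.
have FGD i : F i + G i != 0 -> D i.
  by apply: contra_neqP => /not_orP[/negP/negPn/eqP-> /negP/negPn/eqP->]; rewrite addr0.
split; first exact: sub_finite_set finD.
by rewrite (fsumT_widen FD) (fsumT_widen GD) (fsumT_widen FGD) fsbig_split.
Qed.

(** A linear map can only shrink the support, so both sums may be taken over the finite support of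
    [F]. *)
Lemma finsum_to_linear U V (f : {linear U -> V}) (F : I -> U) s :
  finsum_to F s -> finsum_to (fun i => f (F i)) (f s).
Proof.
move=> [finF <-].
have fFD i : f (F i) != 0 -> [set i | F i != 0] i.
  by apply: contraNN => /eqP ->; rewrite linear0.
split; first exact: sub_finite_set finF.
by rewrite (fsumT_widen fFD) [in RHS](@fsumT_widen _ [set i | F i != 0])//
  !fsbig_finite// linear_sum.
Qed.

Lemma finsum_toB U (F G : I -> U) s t :
  finsum_to F s -> finsum_to G t -> finsum_to (fun i => F i - G i) (s - t).
Proof.
by move=> Fs Gt; apply: finsum_toD => //; exact: (finsum_to_linear (-%R)).
Qed.

Lemma finsum_to_reindex U (h : I -> I) (F : I -> U) s :
  involutive h -> finsum_to F s -> finsum_to (F \o h) s.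
Proof.
move=> hK [finF <-]; split.
  apply: sub_finite_set (finite_image h finF) => i /= Fi.
  by exists (h i); rewrite ?hK.
by apply: esym; apply: reindex_fsbigT; exact: inv_bij.
Qed.

End FiniteSums.

(** * Bilinear maps as linear maps in each variable and on the tensor product *)

Section Bilinear.
Variables (K : fieldType) (U V W : lmodType K) (f : U -> V -> W).
Hypothesis f_bilinear : is_bilinear f.

Definition bilin_l v : {linear U -> W} :=
  HB.pack (f^~ v) (GRing.isLinear.Build K U W *:%R (f^~ v) (f_bilinear.1 v)).
Definition bilin_r u : {linear V -> W} :=
  HB.pack (f u) (GRing.isLinear.Build K V W *:%R (f u) (f_bilinear.2 u)).

Definition tlift_lin : {linear U \otimes V -> W} :=
  HB.pack (tlift f)
    (GRing.isLinear.Build K (U \otimes V) W *:%R (tlift f) (tlift_linear f_bilinear)).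

Lemma tlift_linE u v : tlift_lin (u \ox v) = f u v.
Proof. exact: tliftE. Qed.

Lemma bilin0r u : f u 0 = 0. Proof. exact: (linear0 (bilin_r u)). Qed.
Lemma bilinDl u u' v : f (u + u') v = f u v + f u' v.
Proof. exact: (linearD (bilin_l v)). Qed.
Lemma bilinDr u v v' : f u (v + v') = f u v + f u v'.
Proof. exact: (linearD (bilin_r u)). Qed.
Lemma bilinBl u u' v : f (u - u') v = f u v - f u' v.
Proof. exact: (linearB (bilin_l v)). Qed.
Lemma bilinBr u v v' : f u (v - v') = f u v - f u v'.
Proof. exact: (linearB (bilin_r u)). Qed.
Lemma bilin_suml I (r : seq I) (F : I -> U) v :
  f (\sum_(i <- r) F i) v = \sum_(i <- r) f (F i) v.
Proof. exact: (linear_sum (bilin_l v)). Qed.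
Lemma bilinZ u v a : f (a *: u) v = f u (a *: v).
Proof. by rewrite [LHS](linearZ_LR (bilin_l v)) [RHS](linearZ_LR (bilin_r u)). Qed.
Lemma bilinNl u v : f (- u) v = - f u v.
Proof. exact: (linearN (bilin_l v)). Qed.

End Bilinear.

(** * Permutations and bullet products of triple tensors *)

Section TripleTensors.
Variable K : fieldType.
Implicit Types U V W X Y Z : lmodType K.

(** The transpositions t12 and, below, t23 generate all permutations of the three factors. This one
    is by definition the map occurring in the coalgebra axioms and in [cflipl]. *)
Definition swap12 U V W : (U \otimes V) \otimes W -> (V \otimes U) \otimes W :=
  tmap (@tflip K U V) idfun.

HB.instance Definition _ U V W := GRing.Linear.on (@swap12 U V W).

Definition swap23 U V W : (U \otimes V) \otimes W -> (U \otimes W) \otimes V :=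
  tlift (fun S w => tlift (fun u v => (u \ox w) \ox v) S).

Lemma swap23_bilinear_in U V W (w : W) :
  is_bilinear (fun (u : U) (v : V) => (u \ox w) \ox v).
Proof.
by split=> [v a u u'|u a v v']; rewrite !(otimesDl, otimesDr, otimesZl, otimesZr).
Qed.

Lemma swap23_bilinear U V W :
  is_bilinear (fun (S : U \otimes V) (w : W) => tlift (fun u v => (u \ox w) \ox v) S).
Proof.
split=> [w|S a w w']; first exact/tlift_linear/swap23_bilinear_in.
rewrite -tlift_linear_fun; congr (tlift _ S).
apply/funext => u; apply/funext => v.
by rewrite !(otimesDl, otimesDr, otimesZl, otimesZr).
Qed.

HB.instance Definition _ U V W :=
  GRing.isLinear.Build K ((U \otimes V) \otimes W) ((U \otimes W) \otimes V)
    *:%R (@swap23 U V W) (tlift_linear (@swap23_bilinear U V W)).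

Lemma swap12E U V W (u : U) (v : V) (w : W) :
  swap12 ((u \ox v) \ox w) = (v \ox u) \ox w.
Proof. by rewrite /swap12 tmapE /= tflipE. Qed.

Lemma swap12_tens U V W (S : U \otimes V) (w : W) :
  swap12 (S \ox w) = tflip S \ox w.
Proof. by rewrite /swap12 tmapE. Qed.

Lemma swap23E U V W (u : U) (v : V) (w : W) :
  swap23 ((u \ox v) \ox w) = (u \ox w) \ox v.
Proof.
rewrite /swap23 tliftE; last exact: swap23_bilinear.
by rewrite tliftE//; exact: swap23_bilinear_in.
Qed.

Lemma otimes_is_bilinear U V : is_bilinear (@otimes K U V).
Proof.
by split=> [v|u] a x y; rewrite ?(otimesDl, otimesZl) ?(otimesDr, otimesZr).
Qed.

Lemma tens_ext U V W (f g : {linear U \otimes V -> W}) :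
  (forall u v, f (u \ox v) = g (u \ox v)) -> f =1 g.
Proof.
move=> fg t; elim/tens_ind: t => [|u v t IHt]; first by rewrite !linear0.
by rewrite !linearD fg IHt.
Qed.

Lemma tens_ext3 U V W X (f g : {linear (U \otimes V) \otimes W -> X}) :
  (forall u v w, f ((u \ox v) \ox w) = g ((u \ox v) \ox w)) -> f =1 g.
Proof.
move=> fg; apply: tens_ext => S w.
have ob := otimes_is_bilinear (U \otimes V) W.
by apply: (tens_ext (f := f \o bilin_l ob w) (g := g \o bilin_l ob w)) => u v /=.
Qed.

Lemma tens_ext3r U V W X (f g : {linear U \otimes (V \otimes W) -> X}) :
  (forall u v w, f (u \ox (v \ox w)) = g (u \ox (v \ox w))) -> f =1 g.
Proof.
move=> fg; apply: tens_ext => u S.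
have ob := otimes_is_bilinear U (V \otimes W).
by apply: (tens_ext (f := f \o bilin_r ob u) (g := g \o bilin_r ob u)) => v w /=.
Qed.

Lemma swap12K U V W : cancel (@swap12 U V W) (@swap12 V U W).
Proof.
apply: (tens_ext3 (f := @swap12 V U W \o @swap12 U V W) (g := idfun)) => u v w /=.
by rewrite !swap12E.
Qed.

Lemma swap23K U V W : cancel (@swap23 U V W) (@swap23 U W V).
Proof.
apply: (tens_ext3 (f := @swap23 U W V \o @swap23 U V W) (g := idfun)) => u v w /=.
by rewrite !swap23E.
Qed.

(** Read from left to right, the braid relation and the two involution laws bring every word in the
    transpositions to a normal form, one for each of the six permutations. *)
Lemma swap_braid U V W (t : (U \otimes V) \otimes W) :
  swap23 (swap12 (swap23 t)) = swap12 (swap23 (swap12 t)).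
Proof.
move: t; apply: (tens_ext3
  (f := @swap23 W U V \o @swap12 U W V \o @swap23 U V W)
  (g := @swap12 V W U \o @swap23 V U W \o @swap12 U V W)) => u v w /=.
by rewrite !(swap12E, swap23E).
Qed.

(** Flipping a pair against a third factor is a cyclic permutation. This and the next lemma are what
    make left iterates of the flipped summand show up in right iterates, and conversely. *)
Lemma tassoc_tflip U V W (t : (U \otimes V) \otimes W) :
  tassoc (tflip t) = swap12 (swap23 t).
Proof.
move: t; apply: (tens_ext3 (f := @tassoc K W U V \o @tflip K (U \otimes V) W)
  (g := @swap12 U W V \o @swap23 U V W)) => u v w /=.
by rewrite tflipE tassocE swap23E swap12E.
Qed.

Lemma tflip_tassoc U V W (t : U \otimes (V \otimes W)) :
  tflip t = swap23 (swap12 (tassoc t)).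
Proof.
move: t; apply: (tens_ext3r (f := @tflip K U (V \otimes W))
  (g := @swap23 V U W \o @swap12 U V W \o @tassoc K U V W)) => u v w /=.
by rewrite tflipE tassocE swap12E swap23E.
Qed.

Lemma tassoc_tmap_tflip U V W (t : U \otimes (V \otimes W)) :
  tassoc (tmap idfun (@tflip K V W) t) = swap23 (tassoc t).
Proof.
move: t; apply: (tens_ext3r (f := @tassoc K U W V \o tmap idfun (@tflip K V W))
  (g := @swap23 U V W \o @tassoc K U V W)) => u v w /=.
by rewrite tmapE /= tflipE !tassocE swap23E.
Qed.

Lemma tmapDl U V W X (f g : {linear U -> W}) (h : {linear V -> X}) t :
  tmap (f \+ g) h t = tmap f h t + tmap g h t.
Proof.
move: t; apply: (tens_ext (f := tmap (f \+ g) h) (g := tmap f h \+ tmap g h)) => u v /=.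
by rewrite !tmapE /= otimesDl.
Qed.

Lemma tmapDr U V W X (f : {linear U -> W}) (g h : {linear V -> X}) t :
  tmap f (g \+ h) t = tmap f g t + tmap f h t.
Proof.
move: t; apply: (tens_ext (f := tmap f (g \+ h)) (g := tmap f g \+ tmap f h)) => u v /=.
by rewrite !tmapE /= otimesDr.
Qed.

Lemma tflipK U V : cancel (@tflip K U V) (@tflip K V U).
Proof.
apply: (tens_ext (f := @tflip K V U \o @tflip K U V) (g := idfun)) => u v /=.
by rewrite !tflipE.
Qed.

Lemma tmap_tflip U V W X (f : {linear U -> W}) (g : {linear V -> X}) t :
  tmap f g (tflip t) = tflip (tmap g f t).
Proof.
move: t; apply: (tens_ext (f := tmap f g \o @tflip K V U)
  (g := @tflip K X W \o tmap g f)) => u v /=.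
by rewrite tflipE !tmapE tflipE.
Qed.

(** The middle-four interchange: [bullet] as a linear map on the tensor product of its two
    arguments, so that it can be an argument of [tmap]. *)
Definition interchange U V X Y :
    (U \otimes V) \otimes (X \otimes Y) -> (U \otimes X) \otimes (V \otimes Y) :=
  tlift (@bullet K U V X Y).

HB.instance Definition _ U V X Y :=
  GRing.isLinear.Build K ((U \otimes V) \otimes (X \otimes Y))
    ((U \otimes X) \otimes (V \otimes Y))
    *:%R (@interchange U V X Y) (tlift_linear (@bullet_bilinear K U V X Y)).

(** The bullet product for three factors: pair the last factors first, then regroup the remaining
    four by the interchange. *)
Definition bullet3 U V W X Y Z (T : (U \otimes V) \otimes W)
    (t : (X \otimes Y) \otimes Z) :
    ((U \otimes X) \otimes (V \otimes Y)) \otimes (W \otimes Z) :=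
  tmap (@interchange U V X Y) idfun (bullet T t).

Lemma bullet3_bilinear U V W X Y Z : is_bilinear (@bullet3 U V W X Y Z).
Proof.
have [bl br] := bullet_bilinear (U \otimes V) W (X \otimes Y) Z.
by split=> [t|T] a x y; rewrite /bullet3 ?bl ?br linearP.
Qed.

Lemma bullet3_tens U V W X Y Z (S : U \otimes V) (w : W) (s : X \otimes Y) (z : Z) :
  bullet3 (S \ox w) (s \ox z) = bullet S s \ox (w \ox z).
Proof.
rewrite /bullet3 bulletE tmapE /= /interchange tliftE//; exact: bullet_bilinear.
Qed.

(** Freezing one argument at a time leaves linear maps on a tensor product, which pure tensors
    determine. *)
Lemma bilin_ext U V X Y W (f g : U \otimes V -> X \otimes Y -> W) :
  is_bilinear f -> is_bilinear g ->
  (forall u v x y, f (u \ox v) (x \ox y) = g (u \ox v) (x \ox y)) ->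
  forall T t, f T t = g T t.
Proof.
move=> fb gb fg T t.
apply: (tens_ext (f := bilin_l fb t) (g := bilin_l gb t)) => u v /=.
by apply: (tens_ext (f := bilin_r fb (u \ox v)) (g := bilin_r gb (u \ox v))) => x y /=.
Qed.

Lemma bilin_ext3 U V W X Y Z W'
    (f g : (U \otimes V) \otimes W -> (X \otimes Y) \otimes Z -> W') :
  is_bilinear f -> is_bilinear g ->
  (forall u v w x y z, f ((u \ox v) \ox w) ((x \ox y) \ox z) =
                       g ((u \ox v) \ox w) ((x \ox y) \ox z)) ->
  forall T t, f T t = g T t.
Proof.
move=> fb gb fg T t.
apply: (tens_ext3 (f := bilin_l fb t) (g := bilin_l gb t)) => u v w /=.
by apply: (tens_ext3 (f := bilin_r fb ((u \ox v) \ox w))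
  (g := bilin_r gb ((u \ox v) \ox w))) => x y z /=.
Qed.

Lemma is_bilinear_comp U V W U' V' W' (f : U -> V -> W) (h : {linear W -> W'})
    (k : {linear U' -> U}) (l : {linear V' -> V}) :
  is_bilinear f -> is_bilinear (fun u v => h (f (k u) (l v))).
Proof.
by move=> [fl fr]; split=> [v|u] a x y; rewrite linearP ?fl ?fr linearP.
Qed.

(** Permutations act diagonally on bullet products. This brings the outer t12 of the pre-Lie
    identity down to the two arguments of each product. *)
Lemma swap12_bullet3 U V W X Y Z (T : (U \otimes V) \otimes W)
    (t : (X \otimes Y) \otimes Z) :
  swap12 (bullet3 T t) = bullet3 (swap12 T) (swap12 t).
Proof.
apply: (bilin_ext3 (f := fun T t => swap12 (bullet3 T t))
  (g := fun T t => bullet3 (swap12 T) (swap12 t))).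
- exact: (is_bilinear_comp (@swap12 _ _ _) idfun idfun (@bullet3_bilinear _ _ _ _ _ _)).
- exact: (is_bilinear_comp idfun (@swap12 _ _ _) (@swap12 _ _ _)
    (@bullet3_bilinear _ _ _ _ _ _)).
- by move=> u v w x y z; rewrite !(bullet3_tens, bulletE, swap12E).
Qed.

Lemma tassoc_otimes_bullet U V W X Y Z (u : U) (x : X) (S : V \otimes W)
    (s : Y \otimes Z) :
  tassoc ((u \ox x) \ox bullet S s) = bullet3 (tassoc (u \ox S)) (tassoc (x \ox s)).
Proof.
apply: (bilin_ext (f := fun S s => tassoc ((u \ox x) \ox bullet S s))
  (g := fun S s => bullet3 (tassoc (u \ox S)) (tassoc (x \ox s)))).
- exact: (is_bilinear_comp
    (@tassoc K _ _ _ \o bilin_r (otimes_is_bilinear _ _) (u \ox x))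
    idfun idfun (@bullet_bilinear K _ _ _ _)).
- exact: (is_bilinear_comp idfun
    (@tassoc K _ _ _ \o bilin_r (otimes_is_bilinear _ _) u)
    (@tassoc K _ _ _ \o bilin_r (otimes_is_bilinear _ _) x)
    (@bullet3_bilinear _ _ _ _ _ _)).
- by move=> v w y z; rewrite bulletE !tassocE bullet3_tens bulletE.
Qed.

Lemma is_bilinearB U V W (f g : U -> V -> W) :
  is_bilinear f -> is_bilinear g -> is_bilinear (fun u v => f u v - g u v).
Proof.
move=> [fl fr] [gl gr]; split=> [v|u] a x y; rewrite ?(fl, gl) ?(fr, gr);
by rewrite opprD scalerBr addrACA.
Qed.

End TripleTensors.

(** * The pre-Lie identity in fixed degrees *)

Lemma addr_eq0_opp (V : zmodType) (a r : V) : r = - a -> a + r = 0.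
Proof. by move=> ->; rewrite subrr. Qed.

Lemma addl_eq_id (V : zmodType) (a r : V) : r = 0 -> a + r = a.
Proof. by move=> ->; rewrite addr0. Qed.

(* Cancels the leading summand of a right-nested sum, in a goal _ = 0, against
   its opposite further right. *)
Ltac cancel_head :=
  apply: addr_eq0_opp; rewrite ?opprK;
  lazymatch goal with
  | |- _ = ?a => repeat
    lazymatch goal with
    | |- a = a => reflexivity
    | |- a + _ = a => apply: addl_eq_id
    | |- _ = a => first [rewrite (addrCA _ a) | rewrite (addrC _ a)]
    end
  end.

(* SPr stands for (I (x) Delta_succ) Delta_prec a and SPl for
   (Delta_succ (x) I) Delta_prec a, and similarly for the other variables.  With
   X, Y, Z = B p, B q, B r, iter_r and iter_l are the components of degree
   (p, q, r) of (I (x) delta) delta (a (x) x) and (delta (x) I) delta (a (x) x). *)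
Section PreLieIdentity.
Variables (K : fieldType) (A : lmodType K).
Variables (SSr SSl PSr PSl SPr SPl PPr PPl : (A \otimes A) \otimes A).
Hypothesis hS : SSl + PSl = SSr - swap12 SSr.
Hypothesis hSP : PSr - SPl = swap12 (SPr + PPr).
Hypothesis hP : SPr + PPr = PPl + swap12 PSr.

Definition iter_r (X Y Z : lmodType K) (rXYZ : (X \otimes Y) \otimes Z)
  (rXZY : (X \otimes Z) \otimes Y) (lYZX : (Y \otimes Z) \otimes X)
  (lZYX : (Z \otimes Y) \otimes X) :=
  (bullet3 SSr rXYZ - bullet3 (swap23 PSr) (swap23 rXZY))
  - (bullet3 (swap12 (swap23 SPl)) (swap12 (swap23 lYZX))
     - bullet3 (swap23 (swap12 (swap23 PPl))) (swap23 (swap12 (swap23 lZYX)))).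

Definition iter_l (X Y Z : lmodType K) (lXYZ : (X \otimes Y) \otimes Z)
  (lYXZ : (Y \otimes X) \otimes Z) (rZXY : (Z \otimes X) \otimes Y)
  (rZYX : (Z \otimes Y) \otimes X) :=
  (bullet3 SSl lXYZ - bullet3 (swap12 PSl) (swap12 lYXZ))
  - (bullet3 (swap23 (swap12 SPr)) (swap23 (swap12 rZXY))
     - bullet3 (swap12 (swap23 (swap12 PPr))) (swap12 (swap23 (swap12 rZYX)))).

(** The six components of l, one for each order of the degrees, are independent variables here. The
    [let] bindings encode r = l + t12 l, and the terms under the outer [swap12] have the first two
    degrees exchanged. *)
Lemma prelie_identity (X Y Z : lmodType K)
    (lXYZ : (X \otimes Y) \otimes Z) (lYXZ : (Y \otimes X) \otimes Z)
    (lXZY : (X \otimes Z) \otimes Y) (lZXY : (Z \otimes X) \otimes Y)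
    (lYZX : (Y \otimes Z) \otimes X) (lZYX : (Z \otimes Y) \otimes X) :
  let rXYZ := lXYZ + swap12 lYXZ in let rYXZ := lYXZ + swap12 lXYZ in
  let rXZY := lXZY + swap12 lZXY in let rZXY := lZXY + swap12 lXZY in
  let rYZX := lYZX + swap12 lZYX in let rZYX := lZYX + swap12 lYZX in
  iter_r rXYZ rXZY lYZX lZYX - swap12 (iter_r rYXZ rYZX lXZY lZXY) =
  iter_l lXYZ lYXZ rZXY rZYX - swap12 (iter_l lYXZ lXYZ rZYX rZXY).
Proof.
rewrite /iter_r /iter_l.
(* Each axiom eliminates one variable. In the five that remain, [SSr], [SSl], [PSr], [SPr] and
   [PPr], the identity holds formally. *)
have -> : PSl = SSr - swap12 SSr - SSl by rewrite -hS addrAC subrr add0r.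
have -> : SPl = PSr - swap12 (SPr + PPr) by rewrite -hSP opprB addrC subrK.
have -> : PPl = SPr + PPr - swap12 PSr by rewrite hP addrK.
move=> /=; apply/eqP; rewrite -subr_eq0; apply/eqP.
have D12 U V W (s t : U \otimes V \otimes W) : swap12 (s + t) = swap12 s + swap12 t.
  exact: linearD.
have D23 U V W (s t : U \otimes V \otimes W) : swap23 (s + t) = swap23 s + swap23 t.
  exact: linearD.
have N12 U V W (s : U \otimes V \otimes W) : swap12 (- s) = - swap12 s.
  exact: linearN.
have N23 U V W (s : U \otimes V \otimes W) : swap23 (- s) = - swap23 s.
  exact: linearN.
have bDl := bilinDl (@bullet3_bilinear K A A A X Y Z).
have bDr := bilinDr (@bullet3_bilinear K A A A X Y Z).
have bNl := bilinNl (@bullet3_bilinear K A A A X Y Z).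
(* Expand into signed bullet products whose arguments are variables under reduced words in the
   transpositions, so that equal products become syntactically equal. *)
rewrite !(D12, D23, N12, N23, swap12_bullet3).
rewrite !(swap_braid, swap12K, swap23K).
rewrite !(bDl, bDr, bNl).
rewrite !(opprD, opprK) -!addrA.
(* With the products abstracted, only a cancellation in an abelian group is left. *)
do ?match goal with |- context [bullet3 ?T ?s] =>
  let b := fresh "b" in move: (bullet3 T s) => b
end.
do !cancel_head.
Qed.
End PreLieIdentity.

(** * Iterates of delta on pure tensors *)

Section Delta.
Variables (K : fieldType) (A : lmodType K) (Ds Dp : {linear A -> A \otimes A}).
Variables (B : int -> lmodType K) (eta : {linear dsum B -> B \ohat B}).
Variable delta : {linear dsum (gtens A B) -> gtens A B \ohat gtens A B}.
Hypothesis delta_spec : forall (a : A) (x : dsum B),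
  delta (gotimes a x) =
  cbullet (Ds a) (eta x) - cbullet (tflip (Dp a)) (cflip (eta x)).

Local Notation inclB := (@dsum_val K _ B).
Local Notation inclAB := (@dsum_val K _ (gtens A B)).

Lemma homog_otimes i (a : A) (x : B i) :
  homog (a \ox x : gtens A B i) = gotimes a (homog x).
Proof.
apply/val_inj/functional_extensionality_dep => j /=.
have [<-|ij] := eqVneq i j; first by rewrite !dfwith_in.
by rewrite !dfwith_out// (bilin0r (@otimes_is_bilinear _ _ _)).
Qed.

Lemma component_delta j q r (a : A) (x : B j) :
  component delta (q, r) (a \ox x : gtens A B j) =
  bullet (Ds a) (component eta (q, r) x)
  - bullet (tflip (Dp a)) (tflip (component eta (r, q) x)).
Proof. by rewrite /component homog_otimes delta_spec. Qed.

Lemma component_incl i p (a : A) (x : B i) :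
  component inclAB p (a \ox x : gtens A B i) = a \ox component inclB p x.
Proof. by rewrite /component homog_otimes. Qed.

(** On pure tensors delta hits the first leg only. Its flipped summand exchanges the two legs it
    creates, hence [swap12] on both arguments and the degrees [p] and [q] interchanged. *)
Lemma tmap_component_delta_l i j p q r (T : A \otimes A) (t : B i \otimes B j) :
  tmap (component delta (i:=i) (p, q)) (component inclAB (i:=j) r) (bullet T t) =
  bullet3 (tmap Ds idfun T)
    (tmap (component eta (i:=i) (p, q)) (component inclB (i:=j) r) t)
  - bullet3 (swap12 (tmap Dp idfun T))
    (swap12 (tmap (component eta (i:=i) (q, p)) (component inclB (i:=j) r) t)).
Proof.
move: T t; apply: bilin_ext.
- exact: (is_bilinear_comp (tmap _ _) idfun idfun (@bullet_bilinear K _ _ _ _)).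
- apply: is_bilinearB.
    exact: (is_bilinear_comp idfun (tmap _ _) (tmap _ _)
      (@bullet3_bilinear K _ _ _ _ _ _)).
  exact: (is_bilinear_comp idfun (@swap12 _ _ _ _ \o tmap _ _)
    (@swap12 _ _ _ _ \o tmap _ _) (@bullet3_bilinear K _ _ _ _ _ _)).
move=> a b x y; rewrite bulletE !tmapE.
transitivity
  ((bullet (Ds a) (component eta (p, q) x)
    - bullet (tflip (Dp a)) (tflip (component eta (q, p) x)))
   \ox (b \ox component inclB r y)).
  by congr (_ \ox _); [exact: component_delta | exact: component_incl].
by rewrite (bilinBl (@otimes_is_bilinear _ _ _)) !swap12_tens !bullet3_tens.
Qed.

(** Same argument on the second leg: the legs created are now the last two, so the flip becomes
    [swap23]. *)
Lemma tmap_component_delta_r i j p q r (T : A \otimes A) (t : B i \otimes B j) :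
  tassoc (tmap (component inclAB (i:=i) p) (component delta (i:=j) (q, r))
    (bullet T t)) =
  bullet3 (tassoc (tmap idfun Ds T))
    (tassoc (tmap (component inclB (i:=i) p) (component eta (i:=j) (q, r)) t))
  - bullet3 (swap23 (tassoc (tmap idfun Dp T)))
    (swap23 (tassoc (tmap (component inclB (i:=i) p) (component eta (i:=j) (r, q)) t))).
Proof.
move: T t; apply: bilin_ext.
- exact: (is_bilinear_comp (@tassoc _ _ _ _ \o tmap _ _) idfun idfun
    (@bullet_bilinear K _ _ _ _)).
- apply: is_bilinearB.
    exact: (is_bilinear_comp idfun (@tassoc _ _ _ _ \o tmap _ _)
      (@tassoc _ _ _ _ \o tmap _ _) (@bullet3_bilinear K _ _ _ _ _ _)).
  exact: (is_bilinear_comp idfun (@swap23 _ _ _ _ \o @tassoc _ _ _ _ \o tmap _ _)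
    (@swap23 _ _ _ _ \o @tassoc _ _ _ _ \o tmap _ _)
    (@bullet3_bilinear K _ _ _ _ _ _)).
move=> a b x y; rewrite bulletE !tmapE.
transitivity (tassoc ((a \ox component inclB p x) \ox
  (bullet (Ds b) (component eta (q, r) y)
    - bullet (tflip (Dp b)) (tflip (component eta (r, q) y))))).
  congr (tassoc (_ \ox _)); [exact: component_incl | exact: component_delta].
rewrite (bilinBr (@otimes_is_bilinear _ _ _)) linearB; congr (_ - _).
  exact: tassoc_otimes_bullet.
by rewrite -!tassoc_tmap_tflip !tmapE; exact: tassoc_otimes_bullet.
Qed.

Hypothesis eta_defined : iterates_defined eta.

Local Notation Rterm x p q r := (fun ij : int * int =>
  tassoc (ctmap_term inclB eta (eta x) (p, (q, r)) ij)).
Local Notation Lterm x p q r := (fun ij : int * int =>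
  ctmap_term eta inclB (eta x) ((p, q), r) ij).

Lemma finsum_coiter_r x p q r :
  finsum_to (Rterm x p q r) (coiter_r eta x ((p, q), r)).
Proof. by apply: finsum_to_linear; split=> //; exact: (eta_defined x).1. Qed.

Lemma finsum_coiter_l x p q r :
  finsum_to (Lterm x p q r) (coiter_l eta x ((p, q), r)).
Proof. by split=> //; exact: (eta_defined x).2. Qed.

Let swapij (ij : int * int) := (ij.2, ij.1).
Let swapijK : involutive swapij. Proof. by case. Qed.

(** The formula already holds for the contribution of each degree [(i, j)], and linearity passes it
    to the sums. The flipped summand of the outer delta reads [eta x] in degree [(j, i)], so its
    contributions are reindexed by [swapij]. *)
Lemma finsum_delta_r a x p q r :
  finsum_to (fun ij : int * int =>
     tassoc (ctmap_term inclAB delta (delta (gotimes a x)) (p, (q, r)) ij))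
    (iter_r (tassoc (tmap idfun Ds (Ds a))) (tassoc (tmap idfun Dp (Ds a)))
       (tmap Ds idfun (Dp a)) (tmap Dp idfun (Dp a))
       (coiter_r eta x ((p, q), r)) (coiter_r eta x ((p, r), q))
       (coiter_l eta x ((q, r), p)) (coiter_l eta x ((r, q), p))).
Proof.
pose F ij := iter_r (tassoc (tmap idfun Ds (Ds a))) (tassoc (tmap idfun Dp (Ds a)))
  (tmap Ds idfun (Dp a)) (tmap Dp idfun (Dp a))
  (Rterm x p q r ij) (Rterm x p r q ij)
  (Lterm x q r p (swapij ij)) (Lterm x r q p (swapij ij)).
apply: (@eq_finsum_to _ _ _ _ F) => [[i j]|].
   rewrite /F /iter_r /ctmap_term /= delta_spec.
  transitivity (tassoc (tmap (component inclAB (i:=i) p) (component delta (i:=j) (q, r))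
    (bullet (Ds a) (eta x (i, j)))) -
    tassoc (tmap (component inclAB (i:=i) p) (component delta (i:=j) (q, r))
    (bullet (tflip (Dp a)) (tflip (eta x (j, i)))))).
    by rewrite -linearB -linearB.
  rewrite !tmap_component_delta_r; congr (_ - (_ - _)).
    (* Moving the flip outwards exchanges the legs on which the maps act, so the terms in [Dp a]
       become left iterates, permuted cyclically. *)
    by rewrite !tmap_tflip !tassoc_tflip.
  by rewrite !tmap_tflip !tassoc_tflip.
have b3 := @bullet3_bilinear K A A A (B p) (B q) (B r).
apply: finsum_toB; apply: finsum_toB.
- exact: (finsum_to_linear (bilin_r b3 _) (finsum_coiter_r _ _ _ _)).
- exact: (finsum_to_linear (bilin_r b3 _ \o @swap23 _ _ _ _) (finsum_coiter_r _ _ _ _)).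
- apply: (finsum_to_reindex swapijK
    (F := fun ij => bullet3 _ (swap12 (swap23 (Lterm x q r p ij))))).
  exact: (finsum_to_linear (bilin_r b3 _ \o @swap12 _ _ _ _ \o @swap23 _ _ _ _)
    (finsum_coiter_l _ _ _ _)).
- apply: (finsum_to_reindex swapijK
    (F := fun ij => bullet3 _ (swap23 (swap12 (swap23 (Lterm x r q p ij)))))).
  exact: (finsum_to_linear (bilin_r b3 _ \o @swap23 _ _ _ _ \o @swap12 _ _ _ _
    \o @swap23 _ _ _ _) (finsum_coiter_l _ _ _ _)).
Qed.

(** Mirror image of the previous lemma: here the flip turns the terms in [Dp a] into right
    iterates. *)
Lemma finsum_delta_l a x p q r :
  finsum_to (fun ij : int * int =>
     ctmap_term delta inclAB (delta (gotimes a x)) ((p, q), r) ij)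
    (iter_l (tmap Ds idfun (Ds a)) (tmap Dp idfun (Ds a))
       (tassoc (tmap idfun Ds (Dp a))) (tassoc (tmap idfun Dp (Dp a)))
       (coiter_l eta x ((p, q), r)) (coiter_l eta x ((q, p), r))
       (coiter_r eta x ((r, p), q)) (coiter_r eta x ((r, q), p))).
Proof.
pose F ij := iter_l (tmap Ds idfun (Ds a)) (tmap Dp idfun (Ds a))
  (tassoc (tmap idfun Ds (Dp a))) (tassoc (tmap idfun Dp (Dp a)))
  (Lterm x p q r ij) (Lterm x q p r ij)
  (Rterm x r p q (swapij ij)) (Rterm x r q p (swapij ij)).
apply: (@eq_finsum_to _ _ _ _ F) => [[i j]|].
   rewrite /F /iter_l /ctmap_term /= delta_spec.
  transitivity (tmap (component delta (i:=i) (p, q)) (component inclAB (i:=j) r)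
    (bullet (Ds a) (eta x (i, j))) -
    tmap (component delta (i:=i) (p, q)) (component inclAB (i:=j) r)
    (bullet (tflip (Dp a)) (tflip (eta x (j, i))))).
    by rewrite -linearB.
  rewrite !tmap_component_delta_l; congr (_ - (_ - _)).
    by rewrite !tmap_tflip !tflip_tassoc.
  by rewrite !tmap_tflip !tflip_tassoc.
have b3 := @bullet3_bilinear K A A A (B p) (B q) (B r).
apply: finsum_toB; apply: finsum_toB.
- exact: (finsum_to_linear (bilin_r b3 _) (finsum_coiter_l _ _ _ _)).
- exact: (finsum_to_linear (bilin_r b3 _ \o @swap12 _ _ _ _) (finsum_coiter_l _ _ _ _)).
- apply: (finsum_to_reindex swapijK
    (F := fun ij => bullet3 _ (swap23 (swap12 (Rterm x r p q ij))))).
  exact: (finsum_to_linear (bilin_r b3 _ \o @swap23 _ _ _ _ \o @swap12 _ _ _ _)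
    (finsum_coiter_r _ _ _ _)).
- apply: (finsum_to_reindex swapijK
    (F := fun ij => bullet3 _ (swap12 (swap23 (swap12 (Rterm x r q p ij)))))).
  exact: (finsum_to_linear (bilin_r b3 _ \o @swap12 _ _ _ _ \o @swap23 _ _ _ _
    \o @swap12 _ _ _ _) (finsum_coiter_r _ _ _ _)).
Qed.

End Delta.

(** * Additivity of the iterates of a completed comultiplication *)

Section Iterates.
Variables (K : fieldType) (C : int -> lmodType K).
Variable delta : {linear dsum C -> C \ohat C}.
Local Notation inclC := (@dsum_val K _ C).

(** Definedness and values are recorded together, in a form that is additive in [y]; this is how the
    result on pure tensors spreads to their sums. *)
Definition has_iterates (y : dsum C) (R L : (ctens C C) \ohat C) : Prop :=
  (forall p q r, finsum_to (fun ij : int * int =>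
     tassoc (ctmap_term inclC delta (delta y) (p, (q, r)) ij)) (R ((p, q), r))) /\
  (forall p q r, finsum_to (fun ij : int * int =>
     ctmap_term delta inclC (delta y) ((p, q), r) ij) (L ((p, q), r))).

Lemma has_iterates0 : has_iterates 0 0 0.
Proof.
split=> p q r; apply: eq_finsum_to (finsum_to0 _ _) => ij;
by rewrite /ctmap_term linear0 [tmap _ _ _]linear0 ?linear0.
Qed.

Lemma has_iteratesD y y' R R' L L' : has_iterates y R L -> has_iterates y' R' L' ->
  has_iterates (y + y') (R + R') (L + L').
Proof.
move=> [yR yL] [yR' yL']; split=> p q r.
  apply: eq_finsum_to (finsum_toD (yR p q r) (yR' p q r)) => ij.
  rewrite -linearD; congr tassoc.
  by rewrite /ctmap_term (linearD delta) [LHS]linearD.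
apply: eq_finsum_to (finsum_toD (yL p q r) (yL' p q r)) => ij.
by rewrite /ctmap_term (linearD delta) [LHS]linearD.
Qed.

Lemma has_iteratesE y R L : has_iterates y R L ->
  [/\ ctmap_defined inclC delta (delta y), ctmap_defined delta inclC (delta y),
      coiter_r delta y = R & coiter_l delta y = L].
Proof.
move=> [yR yL].
(* Definedness concerns the terms before reassociation. By [tflip_tassoc] and [tflipK], the map used
   here is a left inverse of [tassoc]. *)
have yR' p q r : finsum_to (fun ij : int * int =>
     ctmap_term inclC delta (delta y) (p, (q, r)) ij)
     (tflip (swap23 (swap12 (R ((p, q), r))))).
  apply: eq_finsum_to (finsum_to_linear (@tflip K _ _ \o @swap23 _ _ _ _ \o
    @swap12 _ _ _ _) (yR p q r)) => ij /=.
  by rewrite -tflip_tassoc tflipK.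
split.
- by case=> p [q r]; exact: (yR' p q r).1.
- by case=> -[p q] r; exact: (yL p q r).1.
- apply: functional_extensionality_dep => -[[p q] r].
  by rewrite /coiter_r /cassoc /= /ctmap (yR' p q r).2 tassoc_tflip swap23K swap12K.
- apply: functional_extensionality_dep => -[[p q] r].
  by rewrite /coiter_l /ctmap (yL p q r).2.
Qed.

End Iterates.

(** * Coordinates along a basis of A and existence of delta *)

Lemma dprod_sumE (K : fieldType) (I J : Type) (U : I -> lmodType K) (s : seq J)
    (F : J -> dprod U) i : (\sum_(k <- s) F k) i = \sum_(k <- s) F k i.
Proof. by elim/big_rec2: _ => // k u v _ <-. Qed.

Section Contraction.
Variables (K : fieldType) (A : lmodType K) (B : int -> lmodType K).

Lemma contract_bilinear (V : lmodType K) (c : {scalar A}) :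
  is_bilinear (fun (a : A) (x : V) => c a *: x).
Proof.
split=> [x|a] b u v; first by rewrite linearP scalerDl scalerA.
by rewrite scalerDr !scalerA mulrC.
Qed.

(** In each degree this is c (x) I. With c a coordinate form, it extracts the B-valued coordinate of
    [y] along a basis vector of A. *)
Definition contract_fun (c : {scalar A}) (y : dsum (gtens A B)) : dprod B :=
  fun i => tlift_lin (contract_bilinear (B i) c) (dsum_val y i).

Lemma contract_finsupp c y : contract_fun c y \in @finsupp_family K int B.
Proof.
case: y => y yfin; apply/asboolP.
move/asboolP: (yfin) => /sub_finite_set; apply=> i /=.
by apply: contraNN => /eqP yi0; rewrite /contract_fun [dsum_val _ _]yi0 linear0.
Qed.

Definition contract (c : {scalar A}) (y : dsum (gtens A B)) : dsum B :=
  DSum (contract_finsupp c y).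

Lemma contract_linear c : linear (contract c).
Proof.
move=> a y z; apply: val_inj; rewrite linearP.
apply: functional_extensionality_dep => i.
rewrite -[RHS]/(a *: contract_fun c y i + contract_fun c z i) /= /contract_fun.
by rewrite -linearP linearP.
Qed.

HB.instance Definition _ c :=
  GRing.isLinear.Build K (dsum (gtens A B)) (dsum B) *:%R (contract c)
    (contract_linear c).

Lemma contract_gotimes c a x : contract c (gotimes a x) = c a *: x.
Proof.
apply: val_inj; rewrite linearZ.
apply: functional_extensionality_dep => i.
by rewrite -[RHS]/(c a *: dsum_val x i) /= /contract_fun tlift_linE.
Qed.

End Contraction.

Section Basis.
Variables (K : fieldType) (A : vectType K) (B : int -> lmodType K).

Definition basis_vec (k : 'I_(\dim {:A})) : A := (vbasis {:A})`_k.

Lemma sum_coord_basis (a : A) : a = \sum_k coord (vbasis {:A}) k a *: basis_vec k.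
Proof. exact: (coord_vbasis (memvf a)). Qed.

Lemma sum_otimes_contract (V : lmodType K) (t : A \otimes V) :
  t = \sum_k basis_vec k \ox tlift_lin (contract_bilinear V (coord (vbasis {:A}) k)) t.
Proof.
elim/tens_ind: t => [|a x t IHt].
  rewrite big1// => k _.
  by rewrite (linear0 (tlift_lin _)) (bilin0r (@otimes_is_bilinear _ _ _)).
under eq_bigr => k _ do rewrite (linearD (tlift_lin _)) otimesDr tlift_linE.
rewrite big_split -IHt; congr (_ + _).
rewrite {1}[a]sum_coord_basis (bilin_suml (@otimes_is_bilinear _ _ _)).
by apply: eq_bigr => k _; rewrite /= otimesZl otimesZr.
Qed.

(** Expansion along a finite basis of A makes every element of A (x) B a finite sum of tensors a (x)
    x, with x possibly spread over several degrees. *)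
Lemma sum_gotimes_contract (y : dsum (gtens A B)) :
  y = \sum_k gotimes (basis_vec k) (contract (coord (vbasis {:A}) k) y).
Proof.
apply: val_inj; rewrite linear_sum; apply: functional_extensionality_dep => i.
by rewrite dprod_sumE; exact: sum_otimes_contract.
Qed.

Lemma cflip_linear (U V : int -> lmodType K) : linear (@cflip K int int U V).
Proof.
by move=> a s t; apply: functional_extensionality_dep => -[i j]; rewrite /cflip linearP.
Qed.

Lemma cbullet_bilinear (U V : int -> lmodType K) :
  is_bilinear (@cbullet K A A int int U V).
Proof.
split=> [t|T] a s u; apply: functional_extensionality_dep => -[i j].
  exact: (@bullet_bilinear K _ _ _ _).1.
exact: (@bullet_bilinear K _ _ _ _).2.
Qed.

Lemma exists_linear (U V : lmodType K) (f : U -> V) :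
  linear f -> exists g : {linear U -> V}, g =1 f.
Proof.
move=> fl.
by exists (HB.pack f (GRing.isLinear.Build K U V *:%R f fl) : {linear U -> V}).
Qed.

Variables (Ds Dp : {linear A -> A \otimes A}) (eta : {linear dsum B -> B \ohat B}).

Definition delta_gotimes (a : A) (x : dsum B) : gtens A B \ohat gtens A B :=
  cbullet (Ds a) (eta x) - cbullet (tflip (Dp a)) (cflip (eta x)).

Lemma delta_gotimes_bilinear : is_bilinear delta_gotimes.
Proof.
have [cbl cbr] := @cbullet_bilinear B B.
by apply: is_bilinearB; split=> [x|a] b u v; rewrite !linearP ?cflip_linear ?(cbl, cbr).
Qed.

(** The prescribed value is bilinear in a and x. It is imposed on the basis expansion of the
    argument, and bilinearity recovers it for every a (x) x. *)
Lemma exists_delta :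
  exists delta : {linear dsum (gtens A B) -> gtens A B \ohat gtens A B},
    forall a x, delta (gotimes a x) = delta_gotimes a x.
Proof.
have [dl dr] := delta_gotimes_bilinear.
have [|delta deltaE] := @exists_linear _ _ (fun y : dsum (gtens A B) =>
    \sum_k delta_gotimes (basis_vec k) (contract (coord (vbasis {:A}) k) y)).
  move=> b y z; rewrite scaler_sumr -big_split; apply: eq_bigr => k _.
  by rewrite linearP dr.
exists delta => a x; rewrite deltaE.
rewrite [in RHS](sum_coord_basis a) (bilin_suml delta_gotimes_bilinear).
by apply: eq_bigr => k _; rewrite contract_gotimes (bilinZ delta_gotimes_bilinear).
Qed.

End Basis.

(** * The pre-Lie identity for delta *)

Section PreLie.
Variables (K : fieldType) (A : vectType K) (Ds Dp : {linear A -> A \otimes A}).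
Variables (B : int -> lmodType K) (eta : {linear dsum B -> B \ohat B}).
Hypothesis hA : leibniz_dendriform_coalgebra Ds Dp.
Hypothesis hB : completed_zinbiel_coalgebra eta.

Lemma zinbiel_coiter_r x p q r : coiter_r eta x ((p, q), r) =
  coiter_l eta x ((p, q), r) + swap12 (coiter_l eta x ((q, p), r)).
Proof. by rewrite (czc_flip hB) (czc_iterate hB). Qed.

Lemma prelie_gotimes
    (delta : {linear dsum (gtens A B) -> gtens A B \ohat gtens A B})
    (delta_spec : forall a x, delta (gotimes a x) = delta_gotimes Ds Dp eta a x)
    a x :
  exists R L, has_iterates delta (gotimes a x) R L /\ R - cflipl R = L - cflipl L.
Proof.
(* [R] and [L] gather the values found in [finsum_delta_r] and [finsum_delta_l] over all degrees. *)
pose R : (ctens (gtens A B) (gtens A B)) \ohat gtens A B := fun pqr =>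
  iter_r (tassoc (tmap idfun Ds (Ds a))) (tassoc (tmap idfun Dp (Ds a)))
    (tmap Ds idfun (Dp a)) (tmap Dp idfun (Dp a))
    (coiter_r eta x ((pqr.1.1, pqr.1.2), pqr.2))
    (coiter_r eta x ((pqr.1.1, pqr.2), pqr.1.2))
    (coiter_l eta x ((pqr.1.2, pqr.2), pqr.1.1))
    (coiter_l eta x ((pqr.2, pqr.1.2), pqr.1.1)).
pose L : (ctens (gtens A B) (gtens A B)) \ohat gtens A B := fun pqr =>
  iter_l (tmap Ds idfun (Ds a)) (tmap Dp idfun (Ds a))
    (tassoc (tmap idfun Ds (Dp a))) (tassoc (tmap idfun Dp (Dp a)))
    (coiter_l eta x ((pqr.1.1, pqr.1.2), pqr.2))
    (coiter_l eta x ((pqr.1.2, pqr.1.1), pqr.2))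
    (coiter_r eta x ((pqr.2, pqr.1.1), pqr.1.2))
    (coiter_r eta x ((pqr.2, pqr.1.2), pqr.1.1)).
exists R, L; split.
  split=> p q r; first exact: (finsum_delta_r delta_spec (czc_defined hB)).
  exact: (finsum_delta_l delta_spec (czc_defined hB)).
apply: functional_extensionality_dep => -[[p q] r].
(* By definition, [cflipl] exchanges the first two degrees and applies [swap12]. *)
transitivity (R ((p, q), r) - swap12 (R ((q, p), r))); first by [].
transitivity (L ((p, q), r) - swap12 (L ((q, p), r))); last by [].
rewrite /R /L /= !zinbiel_coiter_r.
apply: prelie_identity.
- by rewrite -tmapDl; exact: (ldc_s hA).
- by rewrite (ldc_sp hA) tmapDr linearD.
- by rewrite -(ldc_p hA) tmapDr linearD.
Qed.

(** The claim holds at 0 and is additive in [y], so the basis expansion reduces it to pure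
    tensors. *)
Lemma prelie_delta
    (delta : {linear dsum (gtens A B) -> gtens A B \ohat gtens A B})
    (delta_spec : forall a x, delta (gotimes a x) = delta_gotimes Ds Dp eta a x) y :
  exists R L, has_iterates delta y R L /\ R - cflipl R = L - cflipl L.
Proof.
rewrite [y]sum_gotimes_contract; elim/big_ind: _ => [|u v|k _].
- by exists 0, 0; split=> //; exact: has_iterates0.
- move=> [R [L [uRL RL]]] [R' [L' [vRL' RL']]].
  exists (R + R'), (L + L'); split; first exact: has_iteratesD.
  have cfliplD (s t : ctens (gtens A B) (gtens A B) \ohat gtens A B) :
      cflipl (s + t) = cflipl s + cflipl t.
    by apply: functional_extensionality_dep => pqr; rewrite /cflipl [LHS]linearD.
  by rewrite !cfliplD !opprD !(addrACA _ _ (- _)) RL RL'.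
- exact: prelie_gotimes.
Qed.

End PreLie.

Theorem proposition2p7 (K : fieldType)
    (A : vectType K) (Ds Dp : {linear A -> A \otimes A})
    (B : int -> lmodType K) (eta : {linear dsum B -> B \ohat B})
    (hA : leibniz_dendriform_coalgebra Ds Dp)
    (hB : completed_zinbiel_coalgebra eta) :
  let delta_spec
      (delta : {linear dsum (gtens A B) -> gtens A B \ohat gtens A B}) :=
    forall (a : A) (x : dsum B),
      delta (gotimes a x) =
      cbullet (Ds a) (eta x) - cbullet (tflip (Dp a)) (cflip (eta x)) in
  (exists delta, delta_spec delta) /\
  (forall delta, delta_spec delta -> completed_prelie_coalgebra delta).
Proof.
move=> delta_spec; split; first exact: exists_delta.
move=> delta deltaP; split=> y;
  have [R [L [/has_iteratesE[Rdef Ldef RE LE] RL]]] := prelie_delta hA hB deltaP y.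
  by split.
by rewrite RE LE.
Qed.
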